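(* Let $G$ be a split simple group of type $\mathrm A_3$ with character lattice $T^*=\langle\alpha_1,\alpha_2,\alpha_3,\omega_2\rangle$, i.e. $G=SL_4/\mu_2$. Let $P$ be a (standard) parabolic subgroup of type $\mathrm A_1\times\mathrm A_1$ (so $G/P=Gr(2,4)$ is a split $4$-dimensional smooth projective quadric). Then the $D$-module $D_P^\star$ is indecomposable over $\mathbb Z/2\mathbb Z$, i.e. for $R=\mathbb Z/2\mathbb Z$.
   Context: Chow theory with coefficient ring $R$. $\alpha_1,\alpha_2,\alpha_3$ are the simple roots of the root system $\Sigma$ of type $\mathrm A_3$ (standard numbering), $\omega_2$ is the second fundamental weight, $W=\langle s_1,s_2,s_3\rangle$ is the Weyl group and $W_P=\langle s_1,s_3\rangle$. $W^P$ is the set of minimal length representatives of $W/W_P$; for $w\in W$, $\overline w\in W^P$ is the minimal representative of $wW_P$. $S=\mathrm{Sym}_R(T^* )$ is the polynomial ring with its $W$-action, $Q$ is the localization of $S$ at all roots, and $Q_W$ is the twisted group algebra: the free left $Q$-module on $\delta_w$, $w\in W$, with $(q\delta_w)(q'\delta_{w'})=q\,w(q')\delta_{ww'}$. $D\subset Q_W$ is the subalgebra generated by $S$ and all $X_\alpha=\alpha^{-1}(1-\delta_{s_\alpha})$, $\alpha\in\Sigma$ (the nil affine Hecke algebra). $Q_{W/W_P}$ is the free $Q$-module on $\{\delta_w\}_{w\in W^P}$; $p\colon Q_W\to Q_{W/W_P}$, $q\delta_w\mapsto q\delta_{\overline w}$; $D_P=p(D)$. $Q_{W/W_P}^*=\mathrm{Hom}_Q(Q_{W/W_P},Q)$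 has dual basis $\{f_w\}_{w\in W^P}$, and $D_P^\star=\mathrm{Hom}_S(D_P,S)=\{f\in Q_{W/W_P}^*: f(D_P)\subset S\}$, a $D$-module via the restriction of the $\odot$-action $q\delta_w\odot q'f_v=q\,w(q')f_{\overline{wv}}$ ($q,q'\in Q$, $w\in W$, $v\in W^P$) of $Q_W$ on $Q_{W/W_P}^*$. Indecomposable means that $\mathrm{End}_D(D_P^\star)$ has no non-trivial idempotents. *)

(* Defs.v *)
From HB Require Import structures.
From mathcomp Require Import all_boot all_order all_algebra all_fingroup.
From mathcomp Require Import generic_quotient fraction mpoly ring zify.

Set Implicit Arguments.
Unset Strict Implicit.
Unset Printing Implicit Defensive.

Import GRing.Theory.
Local Open Scope ring_scope.

(* The weight lattice of type A_3 is 'rV[int]_4 modulo (1,1,1,1), with roots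
   e_i - e_j, simple roots e_k - e_(k+1) and second fundamental weight
   e_0 + e_1 (indices start at 0, so sroot 0 is alpha_1). *)
Notation weight := 'rV[int]_4.
Notation W := 'S_4.

Definition eps (i : 'I_4) : weight := delta_mx 0 i.
Definition wroot (i j : 'I_4) : weight := eps i - eps j.
Definition ones : weight := const_mx 1.

Definition lo (k : 'I_3) : 'I_4 := widen_ord (leqnSn 3) k.
Definition hi (k : 'I_3) : 'I_4 := lift ord0 k.
Definition k1 : 'I_3 := @Ordinal 3 0 isT.
Definition k2 : 'I_3 := @Ordinal 3 1 isT.
Definition k3 : 'I_3 := @Ordinal 3 2 isT.

Definition sroot (k : 'I_3) : weight := wroot (lo k) (hi k).
Definition omega2 : weight := eps (lo k1) + eps (lo k2).
Definition srefl (k : 'I_3) : W := tperm (lo k) (hi k).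

(* (wact w x)_i = x_(w i). Products of permutations are composed from left to
   right in MathComp, which makes this a LEFT action: see wactM. *)
Definition wact (w : W) (x : weight) : weight := col_perm w x.

Lemma wactM u v x : wact (u * v)%g x = wact u (wact v x).
Proof. by rewrite /wact col_permM. Qed.

Lemma wact_tperm i j x :
  wact (tperm i j) x = x - (x 0 i - x 0 j) *: wroot i j.
Proof.
apply/rowP=> k; rewrite !mxE /= eq_sym [k == j]eq_sym.
case: tpermP => [->|->|/eqP ki /eqP kj].
- rewrite eqxx; case: eqVneq => [->|ij] /=; ring.
- rewrite eqxx; case: eqVneq => [->|ij] /=; ring.
- by rewrite ![_ == k]eq_sym (negPf ki) (negPf kj) subr0 mulr0 subr0.
Qed.

Lemma fundamental_omega2 k :
  omega2 0 (lo k) - omega2 0 (hi k) = (k == k2)%:R.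
Proof. by rewrite !mxE; case: k => -[|[|[|]]]. Qed.

(* T^* = <alpha_1, alpha_2, alpha_3, omega_2>, as a sublattice of 'rV[int]_4
   containing (1,1,1,1). *)
Definition in_Tstar (x : weight) : Prop :=
  exists a1 a2 a3 b c : int,
    x = a1 *: sroot k1 + a2 *: sroot k2 + a3 *: sroot k3
        + b *: omega2 + c *: ones.

(* Coordinates of x \in T^* modulo (1,1,1,1) in the basis
   (alpha_1, alpha_2, omega_2) of T^*: see tbasisP and tcoordK. *)
Definition tbasis (k : 'I_3) : weight :=
  tnth [tuple sroot k1; sroot k2; omega2] k.

Definition tcoord (x : weight) (k : 'I_3) : int :=
  let x0 := x 0 (lo k1) in let x1 := x 0 (lo k2) in
  let x2 := x 0 (lo k3) in let x3 := x 0 (hi k3) in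
  let c := ((x0 + x1 + x2 - x3 *+ 3) %/ 2)%Z in
  tnth [tuple x0 - x3 - c; x3 - x2; c] k.

Lemma row4P (x y : weight) :
  x 0 (lo k1) = y 0 (lo k1) -> x 0 (lo k2) = y 0 (lo k2) ->
  x 0 (lo k3) = y 0 (lo k3) -> x 0 (hi k3) = y 0 (hi k3) -> x = y.
Proof.
move=> h0 h1 h2 h3; apply/rowP=> -[[|[|[|[|//]]]] ltk].
- by rewrite (_ : Ordinal ltk = lo k1) //; apply: val_inj.
- by rewrite (_ : Ordinal ltk = lo k2) //; apply: val_inj.
- by rewrite (_ : Ordinal ltk = lo k3) //; apply: val_inj.
- by rewrite (_ : Ordinal ltk = hi k3) //; apply: val_inj.
Qed.

Lemma sum3 (V : nmodType) (F : 'I_3 -> V) :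
  \sum_k F k = F k1 + F k2 + F k3.
Proof.
rewrite !big_ord_recl big_ord0 addr0 addrA.
by congr (F _ + F _ + F _); apply: val_inj.
Qed.

Lemma tcoordK (a : 'I_3 -> int) (c : int) k :
  tcoord (\sum_k a k *: tbasis k + c *: ones) k = a k.
Proof.
rewrite sum3 /tcoord /tbasis !mxE /=.
rewrite (_ : (_ %/ 2)%Z = a k3); last by lia.
case: k => -[|[|[|//]]] ltk; rewrite /tnth /=.
- by rewrite (_ : Ordinal ltk = k1); [lia | apply: val_inj].
- by rewrite (_ : Ordinal ltk = k2); [lia | apply: val_inj].
- by rewrite (_ : Ordinal ltk = k3); [lia | apply: val_inj].
Qed.

Lemma tbasisP x : in_Tstar x ->
  exists c, x = \sum_k tcoord x k *: tbasis k + c *: ones.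
Proof.
move=> [a1 [a2 [a3 [b [c xE]]]]].
pose a := tnth [tuple a1 - a3; a2 - a3 *+ 2; b + a3 *+ 2].
suff xE' : x = \sum_k a k *: tbasis k + (c - a3) *: ones.
  exists (c - a3); rewrite [LHS]xE'; congr (_ + _); apply: eq_bigr => k _.
  by rewrite xE' tcoordK.
rewrite xE sum3 /a /tbasis /tnth /=.
by apply: row4P; rewrite !mxE /=; lia.
Qed.

Lemma in_TstarP (x : weight) : in_Tstar x <-> (2 %| \sum_i x 0 i)%Z.
Proof.
split=> [[a1 [a2 [a3 [b [c ->]]]]]|].
  by rewrite !big_ord_recl big_ord0 !mxE /=; lia.
pose x0 := x 0 (lo k1); pose x1 := x 0 (lo k2).
pose x2 := x 0 (lo k3); pose x3 := x 0 (hi k3).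
have -> : \sum_i x 0 i = x0 + x1 + x2 + x3.
  rewrite !big_ord_recl big_ord0 addr0 !addrA.
  by congr (x 0 _ + x 0 _ + x 0 _ + x 0 _); apply: val_inj.
move=> xeven.
exists (tcoord x k1), (tcoord x k2), 0, (tcoord x k3), (x 0 (hi k3)).
rewrite /tcoord /tnth /= -/x0 -/x1 -/x2 -/x3.
by apply: row4P; rewrite !mxE /= -?/x0 -?/x1 -?/x2 -?/x3; lia.
Qed.

Lemma in_Tstar_act w x : in_Tstar x -> in_Tstar (wact w x).
Proof.
move=> /in_TstarP xeven; apply/in_TstarP.
rewrite (eq_bigr (fun i => x 0 (w i))) => [|i _]; last by rewrite mxE.
rewrite (_ : \sum_i _ = \sum_i x 0 i) //.
by rewrite [RHS](reindex_inj (@perm_inj _ w)).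
Qed.

Lemma in_Tstar_tbasis k : in_Tstar (tbasis k).
Proof.
apply/in_TstarP; rewrite !big_ord_recl big_ord0.
by case: k => -[|[|[|//]]] ltk; rewrite /tbasis !mxE.
Qed.

Lemma tcoord_sum (a : 'I_3 -> int) (x : 'I_3 -> weight) (c : int) k :
  (forall l, in_Tstar (x l)) ->
  tcoord (\sum_l a l *: x l + c *: ones) k = \sum_l a l * tcoord (x l) k.
Proof.
move=> xT; have [d xE] : exists d : 'I_3 -> int, forall l,
    x l = \sum_m tcoord (x l) m *: tbasis m + d l *: ones.
  exists (fun l => (x l - \sum_m tcoord (x l) m *: tbasis m) 0 (hi k3)) => l.
  have [d dE] := tbasisP (xT l).
  set u := (X in (x l - X) 0 _); have dE' : x l = u + d *: ones := dE.
  by rewrite [in X in X *: ones]dE' addrAC subrr add0r !mxE mulr1.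
have {xE} -> : \sum_l a l *: x l + c *: ones =
    \sum_m (\sum_l a l * tcoord (x l) m) *: tbasis m
    + (\sum_l a l * d l + c) *: ones.
  rewrite scalerDl addrA; congr (_ + _).
  under eq_bigr do rewrite xE scalerDr scaler_sumr scalerA.
  rewrite big_split /= -scaler_suml; congr (_ + _).
  rewrite exchange_big /=; apply: eq_bigr => m _.
  by rewrite scaler_suml; apply: eq_bigr => l _; rewrite scalerA.
exact: tcoordK.
Qed.

(* The symmetric algebra S of T^* over R, as polynomials in the basis (alpha_1, alpha_2,
   omega_2). *)
Notation sym R := {mpoly R[3]}.

Section SymmetricAlgebra.
Variable R : idomainType.

Definition lin (x : weight) : sym R := \sum_k (tcoord x k)%:~R *: 'X_k.

Definition sact (w : 'S_4) (p : sym R) : sym R :=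
  p \mPo [tuple lin (wact w (tbasis k)) | k < 3].

Lemma sactX w k : sact w 'X_k = lin (wact w (tbasis k)).
Proof. by rewrite /sact comp_mpolyXU -tnth_nth tnth_mktuple. Qed.

Lemma sact_lin w x : in_Tstar x -> sact w (lin x) = lin (wact w x).
Proof.
move=> xT; rewrite /lin /sact raddf_sum /=.
have wxE k : tcoord (wact w x) k =
    \sum_l tcoord x l * tcoord (wact w (tbasis l)) k.
  have [c {1}->] := tbasisP xT.
  rewrite /wact linearD linear_sum /= linearZ /= (_ : col_perm w ones = ones).
    under eq_bigr do rewrite linearZ /=.
    by apply: tcoord_sum => l; apply/in_Tstar_act/in_Tstar_tbasis.
  by apply/rowP=> i; rewrite !mxE.
under [RHS]eq_bigr do rewrite wxE.
under eq_bigr do rewrite comp_mpolyZ -/(sact w _) sactX /lin scaler_sumr.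
rewrite exchange_big /=; apply: eq_bigr => k _.
rewrite (rmorph_sum (intr : int -> R)) scaler_suml; apply: eq_bigr => l _.
by rewrite scalerA -intrM.
Qed.

Lemma lin_tbasis k : lin (tbasis k) = 'X_k.
Proof.
have tbE l : tcoord (tbasis k) l = (l == k)%:R.
  suff {1}-> : tbasis k = \sum_m (m == k)%:R *: tbasis m + 0 *: ones.
    exact: (tcoordK (fun m => (m == k)%:R)).
  rewrite scale0r addr0 (bigD1 k) //= eqxx scale1r big1 ?addr0 // => m.
  by move=> /negPf->; rewrite scale0r.
rewrite /lin (bigD1 k) //= tbE eqxx scale1r big1 ?addr0 // => l /negPf lk.
by rewrite tbE lk scale0r.
Qed.

HB.instance Definition _ w := GRing.LRMorphism.copy (sact w) (sact w).

Lemma sact1 p : sact 1%g p = p.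
Proof.
rewrite -[RHS]comp_mpoly_id /sact; congr (_ \mPo _).
apply: eq_from_tnth => k; rewrite !tnth_mktuple.
by rewrite /wact col_perm1 lin_tbasis.
Qed.

Lemma sactM u v p : sact (u * v)%g p = sact u (sact v p).
Proof.
elim/mpolyind: p => [|c m p _ _ IHp]; first by rewrite !rmorph0.
rewrite !rmorphD /= {}IHp !linearZ /= mpolyXE_id !rmorph_prod; congr (_ *: _ + _).
apply: eq_bigr => k _; rewrite !rmorphXn /= !sactX wactM.
by rewrite sact_lin //; apply/in_Tstar_act/in_Tstar_tbasis.
Qed.

Lemma sactK w : cancel (sact w) (sact w^-1%g).
Proof. by move=> p; rewrite -sactM mulVg sact1. Qed.

Lemma sact_eq0 w p : (sact w p == 0) = (p == 0).
Proof. by rewrite -{1}(rmorph0 (sact w)) (can_eq (sactK w)). Qed.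

End SymmetricAlgebra.

(* Q is the localization of S at all roots. As S is a domain, Q is the subset
   inQ of the fraction field of S, and Q_W is the set of elements of the
   twisted group algebra of W over that field with coefficients in Q. *)
Section Localization.
Variable R : idomainType.
Notation F := {fraction (sym R)}.
Notation "x %:F" := (@FracField.tofrac (sym R) x).

Definition rootS (i j : 'I_4) : F := (lin R (wroot i j))%:F.

Definition inS (x : F) : Prop := exists p : sym R, x = p%:F.

Definition inQ (x : F) : Prop :=
  exists (p : sym R) (n : nat),
    x = p%:F / (\prod_(ij : 'I_4 * 'I_4 | ij.1 != ij.2) rootS ij.1 ij.2) ^+ n.

Definition fracact (w : 'S_4) (x : F) : F :=
  (sact w \n_(repr x))%:F / (sact w \d_(repr x))%:F.

Lemma numden (x : F) :
  x = (\n_(repr x))%:F / (\d_(repr x))%:F.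
Proof.
have d0 := denom_ratioP (repr x).
apply: (canRL (mulfK _)); first by rewrite tofrac_eq0.
rewrite -{1}[x]reprK; unlock FracField.tofrac; rewrite -[LHS]FracField.pi_mul.
apply/eqmodP => /=; rewrite /FracField.equivf /FracField.mulf.
by rewrite !numden_Ratio ?oner_neq0 ?mulr1 //= mulrC.
Qed.

Lemma fracactE w p q : q != 0 -> fracact w (p%:F / q%:F) = (sact w p)%:F / (sact w q)%:F.
Proof.
move=> q0; rewrite /fracact; set x := p%:F / q%:F.
have d0 := denom_ratioP (repr x).
apply/eqP; rewrite eqr_div ?tofrac_eq0 ?sact_eq0 // -!tofracM tofrac_eq.
rewrite -!rmorphM (can_eq (sactK w)) -tofrac_eq !tofracM.
by rewrite -eqr_div ?tofrac_eq0 // -numden.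
Qed.

Lemma fracact_zmod w : zmod_morphism (fracact w).
Proof.
move=> x y; rewrite {1}(numden x) {1}(numden y).
have dx := denom_ratioP (repr x); have dy := denom_ratioP (repr y).
rewrite -mulNr -tofracN addf_div ?tofrac_eq0 // -!tofracM -tofracD fracactE ?mulf_neq0 //.
by rewrite rmorphD !rmorphM rmorphN tofracD !tofracM tofracN -addf_div ?tofrac_eq0 ?sact_eq0 // mulNr.
Qed.

Lemma fracact_monoid w : monoid_morphism (fracact w).
Proof.
split=> [|x y].
  by rewrite -[X in fracact w X](divr1 1) -tofrac1 fracactE ?oner_eq0 // rmorph1 divr1.
rewrite {1}(numden x) {1}(numden y).
have dx := denom_ratioP (repr x); have dy := denom_ratioP (repr y).
rewrite mulf_div -!tofracM fracactE ?mulf_neq0 //.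
by rewrite !rmorphM -mulf_div.
Qed.

HB.instance Definition _ w :=
  GRing.isZmodMorphism.Build F F (fracact w) (fracact_zmod w).
HB.instance Definition _ w :=
  GRing.isMonoidMorphism.Build F F (fracact w) (fracact_monoid w).

Lemma fracact_tofrac w p : fracact w p%:F = (sact w p)%:F.
Proof.
by rewrite -[X in fracact w X]divr1 -tofrac1 fracactE ?oner_eq0 // rmorph1 tofrac1 divr1.
Qed.

Lemma fracact1 x : fracact 1%g x = x.
Proof. by rewrite /fracact !sact1 -numden. Qed.

Lemma fracactM u v x : fracact (u * v)%g x = fracact u (fracact v x).
Proof.
rewrite [fracact v x]/fracact fracactE ?sact_eq0 ?denom_ratioP //.
by rewrite /fracact !sactM.
Qed.

End Localization.

(* The twisted group algebra: z stands for \sum_w z w \delta_w. *)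
Definition twalg (R : idomainType) : Type := {ffun 'S_4 -> {fraction (sym R)}}.

HB.instance Definition _ R := GRing.Zmodule.copy (twalg R)
  {ffun 'S_4 -> {fraction (sym R)}}.

Section TwistedAlgebra.
Variable R : idomainType.
Notation F := {fraction (sym R)}.
Notation "x %:F" := (@FracField.tofrac (sym R) x).
Implicit Types (x y z : twalg R) (q : F) (u v w : 'S_4).

Definition qdelta q w : twalg R := [ffun u => if u == w then q else 0].

Definition twmul x y : twalg R :=
  [ffun u => \sum_w x w * fracact w (y (w^-1 * u)%g)].

Lemma twmulA : associative twmul.
Proof.
move=> x y z; apply/ffunP=> u; rewrite !ffunE.
under eq_bigr do rewrite ffunE rmorph_sum mulr_sumr.
under [RHS]eq_bigr do rewrite ffunE mulr_suml.
rewrite [RHS]exchange_big /=; apply: eq_bigr => v _.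
rewrite [RHS](reindex_inj (mulgI v)) /=; apply: eq_bigr => w _.
by rewrite rmorphM mulrA mulKg fracactM invMg mulgA.
Qed.

Lemma twmul1x : left_id (qdelta 1 1%g) twmul.
Proof.
move=> x; apply/ffunP=> u; rewrite ffunE (bigD1 1%g) //= big1 => [|w /negPf w1].
  by rewrite ffunE eqxx mul1r fracact1 invg1 mul1g addr0.
by rewrite ffunE w1 mul0r.
Qed.

Lemma twmulx1 : right_id (qdelta 1 1%g) twmul.
Proof.
move=> x; apply/ffunP=> u; rewrite ffunE (bigD1 u) //= big1 => [|w /negPf wu].
  by rewrite ffunE mulVg eqxx rmorph1 mulr1 addr0.
by rewrite ffunE -eq_mulVg1 wu rmorph0 mulr0.
Qed.

Lemma twmulDl : left_distributive twmul +%R.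
Proof.
move=> x y z; apply/ffunP=> u; rewrite !ffunE -big_split /=.
by apply: eq_bigr => w _; rewrite ffunE mulrDl.
Qed.

Lemma twmulDr : right_distributive twmul +%R.
Proof.
move=> x y z; apply/ffunP=> u; rewrite !ffunE -big_split /=.
by apply: eq_bigr => w _; rewrite ffunE rmorphD mulrDr.
Qed.

Lemma twone_neq0 : qdelta 1 1%g != 0.
Proof.
apply/eqP=> /ffunP/(_ 1%g); rewrite !ffunE eqxx => /eqP.
by rewrite oner_eq0.
Qed.

HB.instance Definition _ := GRing.Zmodule_isNzRing.Build (twalg R)
  twmulA twmul1x twmulx1 twmulDl twmulDr twone_neq0.

Lemma qdeltaM q w q' w' :
  qdelta q w * qdelta q' w' = qdelta (q * fracact w q') (w * w')%g.
Proof.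
apply/ffunP=> u; rewrite !ffunE (bigD1 w) //= big1 => [|v /negPf vw].
  by rewrite !ffunE eqxx -(inj_eq (mulgI w)) mulKVg addr0; case: ifP;
    rewrite ?rmorph0 ?mulr0.
by rewrite ffunE vw mul0r.
Qed.

(* X_alpha for alpha = e_i - e_j. *)
Definition Xroot (i j : 'I_4) : twalg R :=
  qdelta (rootS R i j)^-1 1%g * (1 - qdelta 1 (tperm i j)).

Inductive inD : twalg R -> Prop :=
| inD_S p : inD (qdelta p%:F 1%g)
| inD_X i j : i != j -> inD (Xroot i j)
| inD_add x y : inD x -> inD y -> inD (x + y)
| inD_mul x y : inD x -> inD y -> inD (x * y).

End TwistedAlgebra.

Definition is_prod_srefl (w : 'S_4) (n : nat) : bool :=
  [exists t : n.-tuple 'I_3, w == (\prod_(k <- t) srefl k)%g].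

Lemma srefl_gen : <<[set srefl k | k : 'I_3]>>%g = [set: 'S_4].
Proof.
apply/eqP; rewrite eqEsubset subsetT -(gen_tperm (lo k1)) gen_subG /=.
pose G := [set srefl k | k : 'I_3]; rewrite -/G.
have sG k : srefl k \in <<G>>%g by apply/mem_gen/imset_f.
have g1 : tperm (lo k1) (lo k2) \in <<G>>%g.
  by have := sG k1; rewrite /srefl (_ : hi k1 = lo k2) //; apply: val_inj.
have g2 : tperm (lo k1) (lo k3) \in <<G>>%g.
  have -> : tperm (lo k1) (lo k3) = (tperm (lo k1) (lo k2) ^ srefl k2)%g.
    rewrite tpermJ /srefl tpermD // (_ : lo k3 = hi k2) ?tpermL //.
    exact: val_inj.
  exact: groupJ.
have g3 : tperm (lo k1) (hi k3) \in <<G>>%g.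
  have -> : tperm (lo k1) (hi k3) = (tperm (lo k1) (lo k3) ^ srefl k3)%g.
    by rewrite tpermJ /srefl tpermD ?tpermL.
  exact: groupJ.
apply/subsetP=> _ /imsetP[[i ltk] _ ->].
case: i ltk => [|[|[|[|//]]]] ltk.
- by rewrite (_ : Ordinal ltk = lo k1) ?tperm1 ?group1 //; apply: val_inj.
- by rewrite (_ : Ordinal ltk = lo k2) //; apply: val_inj.
- by rewrite (_ : Ordinal ltk = lo k3) //; apply: val_inj.
- by rewrite (_ : Ordinal ltk = hi k3) //; apply: val_inj.
Qed.

Lemma ex_srefl_word (w : 'S_4) : exists n, is_prod_srefl w n.
Proof.
have : w \in <<[set srefl k | k : 'I_3]>>%g by rewrite srefl_gen inE.
case/gen_prodgP=> n [c cS ->]; exists n; apply/existsP.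
pose k i := odflt k1 [pick l | c i == srefl l].
exists [tuple k i | i < n]; rewrite big_tuple; apply/eqP/eq_bigr=> i _.
rewrite tnth_mktuple /k; case: pickP => [l /eqP //|nol].
by have /imsetP[l _ cl] := cS i; have := nol l; rewrite cl eqxx.
Qed.

Definition len (w : 'S_4) : nat := ex_minn (ex_srefl_word w).

(* minrep is W^P, and bar w is the minimal length representative of w W_P. *)
Definition W_P : {group 'S_4} := <<[set srefl k1; srefl k3]>>%G.

Definition minreps : {set 'S_4} :=
  [set w | [forall v in W_P, (len w <= len (w * v)%g)%N]].

Definition minrep := {w : 'S_4 | w \in minreps}.

Lemma arg_minreps (w : 'S_4) : [arg min_(v < w in (w *: W_P)%g) len v] \in minreps.
Proof.
case: arg_minnP => [|v vw vmin]; first by rewrite lcoset_refl.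
rewrite inE; apply/forall_inP=> u uP; apply: vmin.
by rewrite !mem_lcoset in vw *; rewrite mulgA groupM.
Qed.

Definition bar (w : 'S_4) : minrep := exist (fun v => v \in minreps) _ (arg_minreps w).


Section QuotientModule.
Variable R : idomainType.
Notation F := {fraction (sym R)}.

(* Q_{W/W_P} and its dual: z and f stand for \sum_v z v \delta_v and
   \sum_v f v f_v, where v ranges over W^P. *)
Definition pmap (z : twalg R) : {ffun minrep -> F} :=
  [ffun v => \sum_(w | bar w == v) z w].

Definition in_DP (y : {ffun minrep -> F}) : Prop := exists2 z, inD z & y = pmap z.

Definition ev (f y : {ffun minrep -> F}) : F := \sum_v f v * y v.

Definition odot (z : twalg R) (f : {ffun minrep -> F}) : {ffun minrep -> F} :=
  [ffun v => \sum_w \sum_(u | bar (w * val u)%g == v) z w * fracact w (f u)].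

Definition fdelta (q : F) (v : minrep) : {ffun minrep -> F} :=
  [ffun u => if u == v then q else 0].

Lemma odotE q w q' v :
  odot (qdelta q w) (fdelta q' v) =
  fdelta (q * fracact w q') (bar (w * val v)%g).
Proof.
apply/ffunP=> u; rewrite !ffunE (bigD1 w) //= [X in _ + X]big1 => [|w' w'w].
  rewrite addr0 big_mkcond (bigD1 v) //= big1 => [|v' /negPf v'v].
    by rewrite !ffunE !eqxx addr0 eq_sym.
  by rewrite !ffunE v'v rmorph0 mulr0 if_same.
by apply: big1 => v' _; rewrite ffunE (negPf w'w) mul0r.
Qed.

Definition in_DPstar (f : {ffun minrep -> F}) : Prop :=
  (forall v, inQ (f v)) /\ (forall y, in_DP y -> inS (ev f y)).

(* An endomorphism of the D-module D_P^star is represented by a function phi on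
   the ambient module, of which only the values on D_P^star matter. *)
Record DPstar_endo (phi : {ffun minrep -> F} -> {ffun minrep -> F}) : Prop := {
  endo_stable : forall f, in_DPstar f -> in_DPstar (phi f);
  endo_add : forall f g, in_DPstar f -> in_DPstar g ->
    phi (f + g) = phi f + phi g;
  endo_odot : forall z f, inD z -> in_DPstar f ->
    phi (odot z f) = odot z (phi f)
}.

Definition DPstar_indecomposable : Prop :=
  forall phi, DPstar_endo phi ->
  (forall f, in_DPstar f -> phi (phi f) = phi f) ->
  (forall f, in_DPstar f -> phi f = 0) \/ (forall f, in_DPstar f -> phi f = f).

End QuotientModule.

(* Main.v *)
From HB Require Import structures.
Require Import Defs.
From mathcomp Require Import all_boot all_order all_algebra all_fingroup.
From mathcomp Require Import generic_quotient fraction mpoly ring zify.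

Set Implicit Arguments.
Unset Strict Implicit.
Unset Printing Implicit Defensive.

Import GRing.Theory.

(** The module is indecomposable for a reason that is already visible over the
    fraction field F of S.  Modulo 2 the normal Klein four-subgroup V of S_4
    acts trivially on T^* (sact_klein): two orthogonal roots alpha = e_i - e_j
    and beta = e_k - e_l coincide modulo 2 T^*, and an element x of T^* is
    moved by <x,alpha> alpha + <x,beta> beta, where <x,alpha> + <x,beta> has
    the parity of the sum of the coordinates of x, which is even.  So an
    endomorphism phi of the D-module is an F-linear
    map commuting with the permutation action of V on the six cosets, and
    W-equivariant.

    The six cosets are the 2-subsets of {0,1,2,3}.  They fall into three pairs
    {I, I'} of complementary subsets; the involution of V attached to a pair
    fixes both of its members and exchanges the members of each other pair.
    Thus the matrix B of phi satisfies B_IJ = B_I'J = B_IJ' = B_I'J' when I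
    and J lie in different pairs, and in the product B * B all terms through a
    third pair cancel two by two.  If B is idempotent, then
    B_II' = 2 B_II B_II' = 0, next B_II = B_II ^ 2 is 0 or 1, the same for all
    I by transitivity of W, and B_IJ = (B_II + B_JJ) B_IJ = 0.  Hence B is 0
    or the identity (klein_idempotent).

    To speak of the matrix of phi, D_P^star must be a full lattice in the
    space of functions on the cosets.  That all functions with values in the
    ideal generated by disc, the product of all roots, belong to D_P^star
    (in_DPstar_disc) is obtained without a basis of D.  A system of
    congruences modulo roots and squares of roots (lattice) defines a module
    of S-valued functions on W that is stable under the divided difference
    operators (lattice_Xroot); a module stable in this way pairs with D into S
    (inS_pairing); and multiples of disc satisfy the congruences.

    That the coordinates on W/W_P indexed by minimal representatives are the
    expected ones needs the uniqueness of these representatives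
    (minrep_uniq), which rests on the exchange condition. *)

Local Open Scope nat_scope.

(** * Minimal coset representatives *)

Lemma ord3P (P : 'I_3 -> Prop) : P k1 -> P k2 -> P k3 -> forall k, P k.
Proof.
move=> h1 h2 h3 [[|[|[|//]]] ltk].
- by rewrite (_ : Ordinal ltk = k1) //; apply: val_inj.
- by rewrite (_ : Ordinal ltk = k2) //; apply: val_inj.
- by rewrite (_ : Ordinal ltk = k3) //; apply: val_inj.
Qed.

Lemma ord4P (P : 'I_4 -> Prop) :
  P (lo k1) -> P (lo k2) -> P (lo k3) -> P (hi k3) -> forall i, P i.
Proof.
move=> h0 h1 h2 h3 [[|[|[|[|//]]]] ltk].
- by rewrite (_ : Ordinal ltk = lo k1) //; apply: val_inj.
- by rewrite (_ : Ordinal ltk = lo k2) //; apply: val_inj.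
- by rewrite (_ : Ordinal ltk = lo k3) //; apply: val_inj.
- by rewrite (_ : Ordinal ltk = hi k3) //; apply: val_inj.
Qed.

Lemma val_srefl k (x : 'I_4) :
  srefl k x = (if x == k :> nat then k.+1
               else if x == k.+1 :> nat then k : nat else x) :> nat.
Proof.
rewrite /srefl; case: tpermP => [->|->|] /=.
- by rewrite eqxx.
- by rewrite /bump /= add1n eqn_leq ltnn eqxx.
move=> /eqP; rewrite -val_eqE /= => /negPf-> /eqP.
by rewrite -val_eqE /= /bump add1n => /negPf->.
Qed.

Lemma srefl_swap k (x y : 'I_4) : x < y -> srefl k y < srefl k x ->
  tperm x y = srefl k.
Proof.
move=> xy; rewrite !val_srefl => yx.
have [xk yk] : x = k :> nat /\ y = k.+1 :> nat.
  by move: yx; do !case: eqP => ? //; lia.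
by rewrite /srefl; congr (tperm _ _); apply: val_inj; rewrite //= /bump add1n.
Qed.

(** Along the word t the images of x and y start in increasing order and end in
    decreasing order, so some letter exchanges the two current images.
    Deleting this letter multiplies the product by tperm x y. *)
Lemma exchange (t : seq 'I_3) (x y : 'I_4) :
    x < y -> (\prod_(k <- t) srefl k)%g y < (\prod_(k <- t) srefl k)%g x ->
  exists2 t' : seq 'I_3, size t' = (size t).-1 &
    (\prod_(k <- t') srefl k = tperm x y * \prod_(k <- t) srefl k)%g.
Proof.
elim: t x y => [|k t IHt] x y xy; first by rewrite big_nil !perm1; lia.
rewrite big_cons !permM => yx.
case: (ltngtP (srefl k x) (srefl k y)) => sxy.
- have [t' szt' t'E] := IHt _ _ sxy yx.
  exists (k :: t').
    by rewrite /= szt'; case: (t) yx => //=; rewrite big_nil !perm1; lia.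
  rewrite big_cons t'E !mulgA; congr (_ * _)%g.
  by rewrite -tpermJ conjgE !mulgA mulgV mul1g.
- by exists t => //; rewrite (srefl_swap xy sxy) mulgA /srefl tperm2 mul1g.
- by move: yx; rewrite (val_inj sxy) ltnn.
Qed.

Lemma lenP w : exists2 t : seq 'I_3, size t = len w & w = (\prod_(k <- t) srefl k)%g.
Proof.
rewrite /len; case: ex_minnP => n /existsP[t /eqP ->] _.
by exists t; rewrite ?size_tuple.
Qed.

Lemma len_leq t : len (\prod_(k <- t) srefl k)%g <= size t.
Proof.
rewrite /len; case: ex_minnP => n _; apply.
by apply/existsP; exists (in_tuple t).
Qed.

(** Permutations are composed from left to right, so multiplying w by srefl k on
    the right exchanges the values lo k and hi k: a descent of w^-1. *)
Lemma len_descent k (w : 'S_4) :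
  (w^-1 (hi k) < w^-1 (lo k))%g -> len (w * srefl k)%g < len w.
Proof.
move=> desc; have [t szt wE] := lenP w.
have [|t' szt' t'E] := @exchange t (w^-1 (hi k))%g (w^-1 (lo k))%g desc.
  by rewrite -wE !permKV /= /bump add1n.
have {}t'E : (w * srefl k = \prod_(k <- t') srefl k)%g.
  by rewrite t'E -wE -tpermJ conjgE invgK -!mulgA mulVg mulg1 tpermC.
rewrite t'E (leq_ltn_trans (len_leq t')) // szt' szt.
rewrite prednK ?leqnn // -szt; case: (t) wE => // wE.
by move: desc; rewrite wE big_nil invg1 !perm1 /= /bump add1n; lia.
Qed.

(** The blocks {0,1} and {2,3} are the orbits of W_P on the indices. *)
Definition low (x : 'I_4) : bool := x < 2.

(** W_P is the whole stabilizer of the block {0,1}: an element of the stabilizer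
    is determined by whether it exchanges 0 and 1, and 2 and 3. *)
Lemma mem_WP (p : 'S_4) : reflect (forall x, low (p x) = low x) (p \in W_P).
Proof.
apply: (iffP idP) => [|lowp].
  rewrite -[W_P : {set _}]/(<<_>>%g) => /gen_prodgP[n [c cS ->]].
  elim: n c cS => [|n IHn] c cS x; first by rewrite big_ord0 perm1.
  rewrite big_ord_recl permM IHn => [|i]; last exact: cS.
  have := cS ord0; rewrite !inE => /orP[] /eqP->;
  by rewrite /low val_srefl; case: x => -[|[|[|[|]]]].
have s1P : srefl k1 \in W_P by apply/mem_gen; rewrite !inE eqxx.
have s3P : srefl k3 \in W_P by apply/mem_gen; rewrite !inE eqxx orbT.
(* q applies those of the two generators that p requires. *)
pose q := ((if p (lo k1) == lo k1 then 1 else srefl k1) *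
           (if p (lo k3) == lo k3 then 1 else srefl k3))%g.
have qP : q \in W_P by rewrite groupM //; case: ifP.
suff -> : p = q by [].
have p_inj x y : x != y -> p x != p y by rewrite (inj_eq perm_inj).
apply/permP=> x; apply: val_inj; rewrite /q permM.
move: (lowp (lo k1)) (lowp (lo k2)) (lowp (lo k3)) (lowp (hi k3)).
move: (p_inj (lo k1) (lo k2) isT) (p_inj (lo k3) (hi k3) isT).
move: (ltn_ord (p (lo k3))) (ltn_ord (p (hi k3))).
rewrite -!val_eqE /= /low /bump /=.
elim/ord4P: x; do 2!case: ifP;
  rewrite ?perm1 ?val_srefl /= ?perm1 ?val_srefl /= /bump /=; lia.
Qed.

Lemma minrep_ascent k (v : 'S_4) : v \in minreps -> k \in [:: k1; k3] ->
  (v^-1 (lo k) < v^-1 (hi k))%g.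
Proof.
rewrite inE => /forall_inP vmin kP.
have skP : srefl k \in W_P.
  by apply: mem_gen; move: kP; rewrite !inE => /orP[]/eqP->; rewrite eqxx ?orbT.
case: ltngtP => // [desc|/val_inj/perm_inj/eqP].
  by have := vmin _ skP; rewrite leqNgt len_descent.
by rewrite -val_eqE /= /bump add1n; lia.
Qed.

(** The inverse of a minimal representative increases on each of the two blocks
    (minrep_ascent), and no nontrivial element of W_P preserves this. *)
Lemma minrep_uniq (u v : 'S_4) :
  u \in minreps -> v \in minreps -> (u^-1 * v)%g \in W_P -> u = v.
Proof.
move=> umin vmin uvP.
set p := (u^-1 * v)%g in uvP; have lowp := mem_WP _ uvP.
suff : p = 1%g by move/eqP; rewrite -eq_mulVg1 => /eqP.
have vV x : (v^-1 (p x) = u^-1 x)%g by rewrite /p permM permK.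
have p_inj x y : x != y -> p x != p y by rewrite (inj_eq perm_inj).
have A k : k \in [:: k1; k3] -> ~ (p (lo k) = hi k /\ p (hi k) = lo k).
  move=> kP [plo phi]; have := minrep_ascent umin kP; have := minrep_ascent vmin kP.
  by rewrite -!vV plo phi; lia.
have A1 := A k1 isT; have {A}A3 := A k3 isT.
apply/permP=> x; rewrite perm1; apply: val_inj.
have {}A1 : ~ (p (lo k1) = 1 :> nat /\ p (lo k2) = 0 :> nat).
  have -> : lo k2 = hi k1 by apply: val_inj.
  by move=> [h h']; apply: A1; split; apply: val_inj.
have {}A3 : ~ (p (lo k3) = 3 :> nat /\ p (hi k3) = 2 :> nat).
  by move=> [h h']; apply: A3; split; apply: val_inj.
move: (lowp (lo k1)) (lowp (lo k2)) (lowp (lo k3)) (lowp (hi k3)).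
move: (p_inj (lo k1) (lo k2) isT) (p_inj (lo k3) (hi k3) isT).
move: (ltn_ord (p (lo k3))) (ltn_ord (p (hi k3))).
rewrite -!val_eqE /low /bump /=.
by elim/ord4P: x; rewrite /= /bump /=; lia.
Qed.

(** * The six cosets as 2-subsets *)

(** The coset w W_P is the 2-subset of the indices that w sends to {0,1};
    side w is the indicator function of this subset. *)
Definition side (w : 'S_4) (x : 'I_4) : bool := low (w x).

Lemma side_WP (u v : 'S_4) : reflect (side u =1 side v) ((u^-1 * v)%g \in W_P).
Proof.
apply: (iffP (mem_WP _)) => uv x; first by rewrite /side -uv permM permK.
by rewrite permM -[low _]/(side v _) -uv /side permKV.
Qed.

Lemma side_bar (w : 'S_4) : side (val (bar w)) =1 side w.
Proof.
move=> x; apply/esym; move: x; apply/side_WP.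
rewrite /bar /=; case: arg_minnP => [|v]; first by rewrite lcoset_refl.
by rewrite mem_lcoset.
Qed.

Lemma barP (u v : 'S_4) : reflect (side u =1 side v) (bar u == bar v).
Proof.
apply: (iffP eqP) => [uv x|uv]; first by rewrite -[LHS]side_bar uv side_bar.
apply: val_inj; apply: minrep_uniq (valP (bar u)) (valP (bar v)) _.
by apply/side_WP => x; rewrite !side_bar.
Qed.

Lemma barK (v : minrep) : bar (val v) = v.
Proof.
apply: val_inj; apply: minrep_uniq (valP (bar (val v))) (valP v) _.
by apply/side_WP => x; rewrite side_bar.
Qed.

Lemma bar_mul_val (w u : 'S_4) : bar (w * val (bar u)) = bar (w * u).
Proof. by apply/eqP/barP => x; rewrite /side !permM; apply: side_bar. Qed.

Lemma bar_mul_inj (w u v : 'S_4) : bar (w * u) = bar (w * v) -> bar u = bar v.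
Proof.
move=> /eqP/barP wuv; apply/eqP/barP => x.
by have := wuv (w^-1%g x); rewrite /side !permM !permKV.
Qed.

(** The involution of the Klein four-group that preserves the 2-subset
    {0, hi k}. *)
Definition klein (k : 'I_3) : 'S_4 :=
  tnth [tuple (tperm (lo k1) (lo k2) * tperm (lo k3) (hi k3))%g;
              (tperm (lo k1) (lo k3) * tperm (lo k2) (hi k3))%g;
              (tperm (lo k1) (hi k3) * tperm (lo k2) (lo k3))%g] k.

(** The index (k, false) stands for the 2-subset {0, hi k}, and (k, true) for its
    complement, so that k labels a pair of complementary subsets. *)
Definition coset_rep (a : 'I_3 * bool) : 'S_4 :=
  (tperm (lo k2) (hi a.1) * (if a.2 then klein k2 else 1))%g.

Lemma side_coset_rep a x :
  side (coset_rep a) x = ((x == lo k1) || (x == hi a.1)) (+) a.2.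
Proof.
case: a => k e; rewrite /side /coset_rep permM /=.
have -> y : low ((if e then klein k2 else 1)%g y) = low y (+) e.
  case: e; last by rewrite perm1 addbF.
  by rewrite /klein /tnth /= permM; elim/ord4P: y; do 2!(rewrite permE /=).
congr (_ (+) _); elim/ord4P: x; case: k => -[|[|[|//]]] lt3;
  rewrite permE /=; reflexivity.
Qed.

(** Given u, the required k is the index for which hi k lies on the same side as
    0; there is exactly one, as each side has two elements. *)
Lemma coset_rep_surj (u : 'S_4) : exists a, side (coset_rep a) =1 side u.
Proof.
(* Both sums count the two elements of a 2-subset. *)
have : \sum_x side u x = \sum_x low x.
  by rewrite [RHS](reindex_inj (@perm_inj _ u)).
have sum4 (F : 'I_4 -> nat) :
    \sum_x F x = F (lo k1) + F (lo k2) + F (lo k3) + F (hi k3).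
  rewrite !big_ord_recl big_ord0 addn0 !addnA.
  by congr (F _ + F _ + F _ + F _); apply: val_inj.
rewrite !sum4 /low /= /bump /= => uc.
have [k kE] : exists k, forall x,
    (side u x == side u (lo k1)) = (x == lo k1) || (x == hi k).
  move: uc; case E0: (side u (lo k1)); case E1: (side u (lo k2));
  case E2: (side u (lo k3)); case E3: (side u (hi k3)) => //= _;
  [exists k1|exists k2|exists k3|exists k3|exists k2|exists k1];
  by elim/ord4P; rewrite ?E0 ?E1 ?E2 ?E3.
exists (k, ~~ side u (lo k1)) => x; rewrite side_coset_rep -kE /=.
by case: (side u x); case: (side u (lo k1)).
Qed.

Lemma coset_rep_bij : bijective (fun a => bar (coset_rep a)).
Proof.
apply: inj_card_bij => [[k e] [l f] /eqP/barP kl|].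
  have ef : e = f.
    have := kl (lo k1); rewrite !side_coset_rep eqxx /= => /(congr1 negb).
    by rewrite !negbK.
  rewrite ef; congr (_, _); have := kl (hi k); rewrite !side_coset_rep /= ef eqxx.
  move/addIb/esym; rewrite -val_eqE /= /bump /= !add1n.
  by move/eqP=> [kl']; apply: val_inj.
have [h hK] : exists h, forall v, bar (coset_rep (h v)) = v.
  apply: (@fin_all_exists minrep _ (fun v a => bar (coset_rep a) = v)) => v.
  have [a aE] := coset_rep_surj (val v).
  by exists a; rewrite -[RHS]barK; apply/eqP/barP.
by apply: (leq_card h); apply: (can_inj (g := fun a => bar (coset_rep a))).
Qed.

(** Each involution of the Klein four-group preserves the two subsets of its own
    pair and complements the four others. *)
Lemma klein_coset_rep k i e :
  bar (klein k * coset_rep (i, e)) = bar (coset_rep (i, e (+) (i != k))).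
Proof.
apply/eqP/barP=> x; rewrite {1}/side permM -/(side _ _) !side_coset_rep /=.
rewrite [e (+) _]addbC [RHS]addbA; congr (_ (+) e).
elim/ord3P: k; elim/ord3P: i; elim/ord4P: x;
  rewrite /klein /tnth /= permM; do 2!(rewrite permE /=); reflexivity.
Qed.

Local Open Scope ring_scope.

(** * Idempotents commuting with the Klein four-group *)

Section KleinIdempotent.
Variables (F : idomainType) (B : 'I_3 * bool -> 'I_3 * bool -> F).
Hypothesis char2 : forall x : F, x + x = 0.
Hypothesis B_klein : forall k i e j f,
  B (i, e (+) (i != k)) (j, f (+) (j != k)) = B (i, e) (j, f).
Hypothesis B_idem : forall a b, B a b = \sum_c B a c * B c b.

Let sum_side i g (G : 'I_3 * bool -> F) :
  G (i, false) + G (i, true) = G (i, g) + G (i, ~~ g).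
Proof. by case: g; rewrite // addrC. Qed.

Let sum_pairs (G : 'I_3 * bool -> F) :
  \sum_c G c = \sum_i (G (i, false) + G (i, true)).
Proof.
rewrite (eq_bigr (fun c => G (c.1, c.2))) => [|[]//].
rewrite -(pair_bigA _ (fun i e => G (i, e))) /=.
by apply: eq_bigr => i _; rewrite addrC big_bool.
Qed.

(** The involution attached to the pair i fixes (i, e) and exchanges the two
    members of every other pair k. *)
Let B_row i e k g : k != i -> B (i, e) (k, ~~ g) = B (i, e) (k, g).
Proof.
by move=> ki; rewrite -(B_klein i i e k g) eqxx ki addbF addbT.
Qed.

Let B_col i e k g : k != i -> B (k, ~~ g) (i, e) = B (k, g) (i, e).
Proof.
by move=> ki; rewrite -(B_klein i k g i e) eqxx ki addbF addbT.
Qed.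

(** For a pair k different from both i and j, the two terms of the matrix product
    that pass through k are equal, and they cancel. *)
Let B_sum i e j f :
  B (i, e) (j, f) =
    \sum_(k | (k == i) || (k == j))
      (B (i, e) (k, false) * B (k, false) (j, f)
       + B (i, e) (k, true) * B (k, true) (j, f)).
Proof.
rewrite B_idem sum_pairs (bigID (fun k => (k == i) || (k == j))) /=.
rewrite [X in _ + X]big1 ?addr0 // => k; rewrite negb_or => /andP[ki kj].
by rewrite -(B_row e false ki) -(B_col f false kj) char2.
Qed.

Let B_pair i e f : B (i, ~~ e) (i, ~~ f) = B (i, e) (i, f).
Proof.
have [k ki] : exists k, i != k.
  by elim/ord3P: i; [exists k2|exists k1|exists k1].
by rewrite -(B_klein k) ki !addbT !negbK.
Qed.

Let B_anti i e : B (i, e) (i, ~~ e) = 0.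
Proof.
rewrite B_sum (big_pred1 i) => [|k]; last by rewrite orbb.
rewrite (sum_side i e (fun c => B (i, e) c * B c (i, ~~ e))).
by rewrite B_pair mulrC char2.
Qed.

Let B_diag i e : B (i, e) (i, e) = 0 \/ B (i, e) (i, e) = 1.
Proof.
have : B (i, e) (i, e) * (1 - B (i, e) (i, e)) = 0.
  apply/eqP; rewrite mulrBr mulr1 subr_eq0; apply/eqP.
  rewrite {1}B_sum (big_pred1 i) => [|k]; last by rewrite orbb.
  by rewrite (sum_side i e (fun c => B (i, e) c * B c (i, e))) B_anti mul0r addr0.
move/eqP; rewrite mulf_eq0 subr_eq0 => /orP[/eqP->|/eqP<-]; by [left|right].
Qed.

(** The entries between complementary points vanish first; this makes the diagonal
    entries idempotent, so 0 or 1.  The hypothesis makes them all equal, and then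
    every remaining entry is a multiple of 2. *)
Lemma klein_idempotent :
    (forall a b, B a a = 0 -> B b b = 0) ->
  (forall a b, B a b = 0) \/ (forall a b, B a b = (a == b)%:R).
Proof.
move=> Bconst.
have diag : (forall a, B a a = 0) \/ (forall a, B a a = 1).
  have [B0|B1] := B_diag k1 false; [left=> a; exact: Bconst B0|right=> -[i e]].
  have [B0|//] := B_diag i e; have {}B0 := Bconst _ (k1, false) B0.
  by move: B1; rewrite B0 => /esym/eqP; rewrite oner_eq0.
have off i e j f : i != j -> B (i, e) (j, f) = 0.
  move=> ij; rewrite B_sum (bigD1 i) /= ?eqxx // (big_pred1 j) => [|k]; last first.
    by rewrite andb_orl andbN /=; case: eqVneq => [->|//]; rewrite eq_sym ij.
  rewrite (sum_side i e (fun c => B (i, e) c * B c (j, f))).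
  rewrite (sum_side j f (fun c => B (i, e) c * B c (j, f))).
  rewrite B_anti mul0r addr0 -[X in B (j, ~~ f) (j, X)]negbK B_anti mulr0 addr0.
  by case: diag => dE; rewrite !dE ?mul0r ?mulr0 ?addr0 // mul1r mulr1 char2.
case: diag => dE; [left|right] => -[i e] [j f].
  case: (eqVneq i j) => [<-|/off->//]; case: (eqVneq f e) => [->|] //.
  by case: e f => -[] // _; rewrite B_anti.
rewrite xpair_eqE; case: (eqVneq i j) => [<-|/off->//] /=.
by case: e f => -[] /=; rewrite ?dE // B_anti.
Qed.
End KleinIdempotent.

(** * The symmetric algebra in characteristic two *)

Section CharTwo.
Variable R : idomainType.
Hypothesis R2 : 2%N \in [pchar R].

Notation S := (sym R).
Notation F := {fraction S}.
Notation "x %:F" := (@FracField.tofrac S x).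
Notation root i j := (lin R (wroot i j)).

Lemma pchar2_S : 2%N \in [pchar S].
Proof.
apply/andP; split=> //; rewrite -scaler_nat.
by rewrite (pcharf0 R2) scale0r.
Qed.

Lemma addSS (p : S) : p + p = 0.
Proof. exact: addrr_pchar2 pchar2_S p. Qed.

Lemma addFF (x : F) : x + x = 0.
Proof.
by rewrite -(mulr1 x) -mulrDr -(tofrac1 S) -tofracD addSS tofrac0 mulr0.
Qed.

Lemma oppS (p : S) : - p = p.
Proof. exact: oppr_pchar2 pchar2_S p. Qed.

Lemma oppF (x : F) : - x = x.
Proof. by apply/eqP; rewrite eq_sym -subr_eq0 opprK addFF. Qed.

Lemma in_Tstar_wroot i j : in_Tstar (wroot i j).
Proof.
apply/in_TstarP; rewrite !big_ord_recl big_ord0.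
by elim/ord4P: i; elim/ord4P: j; rewrite !mxE.
Qed.

(** Only linearity on T^* can be expected: the last coordinate involves a
    division by two. *)
Lemma lin_sub (x y : weight) (m : int) : in_Tstar x -> in_Tstar y ->
  lin R (x - m *: y) = lin R x - m%:~R *: lin R y.
Proof.
move=> xT yT; rewrite /lin scaler_sumr -sumrB; apply: eq_bigr => k _.
rewrite scalerA -scalerBl -intrM -intrB; congr (_%:~R *: _).
have := @tcoord_sum (tnth [tuple 1; - m; 0]) (tnth [tuple x; y; 0]) 0 k.
rewrite !sum3 /tnth /= !scale0r !addr0 !scale1r !scaleNr !mul0r mul1r addr0 mulNr.
apply.
elim/ord3P => //=; apply/in_TstarP.
by rewrite big1 // => i _; rewrite mxE.
Qed.

Lemma wact_wroot (w : 'S_4) i j :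
  wact w (wroot i j) = wroot (w^-1 i)%g (w^-1 j)%g.
Proof.
apply/rowP=> x; rewrite !mxE !eqxx /=.
by rewrite !(can2_eq (permK w) (permKV w)).
Qed.

Lemma sact_root (w : 'S_4) i j : sact w (root i j) = root (w^-1 i)%g (w^-1 j)%g.
Proof. by rewrite sact_lin ?wact_wroot //; apply: in_Tstar_wroot. Qed.

Lemma lin_mod2 (x y : weight) :
  (forall k, (2 %| tcoord x k - tcoord y k)%Z) -> lin R x = lin R y.
Proof.
move=> xy; apply: eq_bigr => k _; congr (_ *: _).
apply/eqP; rewrite -subr_eq0 -intrB; have /dvdzP[m ->] := xy k.
by rewrite intrM (_ : 2%:~R = 0 :> R) ?mulr0 //; apply: (pcharf0 R2).
Qed.

Lemma sact_id (w : 'S_4) :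
  (forall k l, (2 %| tcoord (wact w (tbasis k)) l - tcoord (tbasis k) l)%Z) ->
  forall p : S, sact w p = p.
Proof.
move=> wE p; rewrite -[RHS]comp_mpoly_id /sact; congr (_ \mPo _).
apply: eq_from_tnth => k; rewrite !tnth_mktuple -[RHS]lin_tbasis.
exact: lin_mod2.
Qed.

(** Orthogonal roots coincide modulo 2 T^*, and the two multiples of them by which
    the double transposition moves x in T^* add up to an even multiple, because
    the coordinates of x have an even sum. *)
Lemma sact_klein k (p : S) : sact (klein k) p = p.
Proof.
apply: sact_id => m l; rewrite /tcoord !mxE.
elim/ord3P: k; rewrite /klein /tnth /= !permM;
 rewrite !permE /= ?permE /=;
 elim/ord3P: m; elim/ord3P: l; rewrite /tbasis /tnth /= !mxE; reflexivity.
Qed.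

Lemma root01 : root (lo k1) (lo k2) = 'X_k1.
Proof. by rewrite -lin_tbasis; congr (lin _ (wroot _ _)); apply: val_inj. Qed.

Lemma root23 : root (lo k3) (hi k3) = 'X_k1.
Proof.
rewrite -root01; apply: lin_mod2 => l; rewrite /tcoord !mxE.
by elim/ord3P: l.
Qed.

Lemma root02 : root (lo k1) (lo k3) = 'X_k1 + 'X_k2.
Proof.
have := lin_sub (-1) (in_Tstar_tbasis k1) (in_Tstar_tbasis k2).
rewrite !lin_tbasis scaleN1r opprK rmorphN1 scaleN1r opprK => <-.
congr (lin _ _); rewrite /tbasis /tnth /= /sroot /wroot.
rewrite (_ : hi k1 = lo k2) ?addrA ?subrK //.
exact: val_inj.
Qed.

Definition dvdS (r p : S) : Prop := exists q, p = r * q.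

Lemma dvdSD r p q : dvdS r p -> dvdS r q -> dvdS r (p + q).
Proof. by move=> [a ->] [b ->]; exists (a + b); rewrite mulrDr. Qed.

Lemma dvdS_mulr r p q : dvdS r p -> dvdS r (p * q).
Proof. by move=> [a ->]; exists (a * q); rewrite mulrA. Qed.

Lemma dvdS_sact w r p : dvdS r p -> dvdS (sact w r) (sact w p).
Proof. by move=> [a ->]; exists (sact w a); rewrite rmorphM. Qed.

Lemma perm4 i j k l : uniq [:: i; j; k; l : 'I_4] ->
  exists w : 'S_4, [/\ w (lo k1) = i, w (lo k2) = j, w (lo k3) = k & w (hi k3) = l].
Proof.
move=> ijkl.
have inj : injective (tnth [tuple i; j; k; l]) by apply/tuple_uniqP.
by exists (perm inj); split; rewrite permE.
Qed.

(** As W is 4-transitive on the indices, statements about roots can be transported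
    to alpha_1, which equals alpha_3 modulo 2, and alpha_1 + alpha_2. *)
Lemma sact_perm4 i j k l : uniq [:: i; j; k; l : 'I_4] ->
  exists w : 'S_4, [/\ root i j = sact w 'X_k1, root k l = sact w 'X_k1 &
     root i k = sact w ('X_k1 + 'X_k2)].
Proof.
move=> /perm4[w [wi wj wk wl]]; exists w^-1%g.
rewrite -root02 -{1}root01 -root23 !sact_root invgK wi wj wk wl.
by split.
Qed.

(** The difference (e_i - e_j) - (e_k - e_l) is 2 (e_i + e_l) minus (1,1,1,1). *)
Lemma root_compl i j k l : uniq [:: i; j; k; l : 'I_4] -> root i j = root k l.
Proof. by case/sact_perm4 => w [-> ->]. Qed.

Lemma root_sym i j : root i j = root j i.
Proof.
have -> : wroot j i = wroot i j - 2 *: wroot i j.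
  by apply/rowP=> x; rewrite !mxE; ring.
rewrite lin_sub; try exact: in_Tstar_wroot.
by rewrite (_ : 2%:~R = 0 :> R) ?scale0r ?subr0 //; apply: (pcharf0 R2).
Qed.

Lemma uniq4_ext (i j : 'I_4) : i != j -> exists k l, uniq [:: i; j; k; l].
Proof.
by elim/ord4P: i; elim/ord4P: j => //= _;
 do ?[by exists (lo k3), (hi k3)|by exists (lo k2), (hi k3)|by exists (lo k2), (lo k3)|
      by exists (lo k1), (hi k3)|by exists (lo k1), (lo k3)|by exists (lo k1), (lo k2)].
Qed.

Lemma mvar_neq0 k : 'X_k != 0 :> S.
Proof. by rewrite -msize_poly_eq0 msizeX mdeg1. Qed.

Lemma root_neq0 i j : i != j -> root i j != 0.
Proof.
move=> /uniq4_ext[k [l]] /sact_perm4[w [-> _ _]].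
by rewrite sact_eq0 mvar_neq0.
Qed.

(** An algebra endomorphism that is the identity on the variables modulo r is the
    identity modulo r: the elements on which this holds are closed under
    products. *)
Lemma dvdS_sub_lrmorph (r : S) (theta : {lrmorphism S -> S}) :
  (forall k, dvdS r ('X_k - theta 'X_k)) -> forall p, dvdS r (p - theta p).
Proof.
move=> CX p; pose C (p : S) := dvdS r (p - theta p); rewrite -/(C p).
have CM q q' : C q -> C q' -> C (q * q').
  move=> Cq Cq';
    rewrite /C (_ : _ - _ = (q - theta q) * q' + (q' - theta q') * theta q).
    by apply: dvdSD; apply: dvdS_mulr.
  rewrite rmorphM /=; ring.
have C1 : C 1 by exists 0; rewrite rmorph1 subrr mulr0.
elim/mpolyind: p => [|c m p _ _ IHp].
  by exists 0; rewrite /C rmorph0 subr0 mulr0.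
rewrite /C rmorphD /= opprD addrACA; apply: dvdSD IHp.
rewrite linearZ /= -scalerBr -mul_mpolyC mulrC; apply: dvdS_mulr.
rewrite -/(C _) mpolyXE_id; apply: (big_ind C) => // k _.
elim: (m k) => [|n IHn]; first by rewrite expr0.
rewrite exprS; apply: CM IHn; exact: CX.
Qed.

(** Reduction modulo the variable alpha_1, kept inside S: it tests divisibility by
    alpha_1. *)
Definition kill_alpha1 (p : S) : S :=
  p \mPo [tuple if k == k1 then 0 else 'X_k | k < 3].

HB.instance Definition _ := GRing.LRMorphism.copy kill_alpha1 kill_alpha1.

Lemma kill_alpha1X k : kill_alpha1 'X_k = if k == k1 then 0 else 'X_k.
Proof. by rewrite /kill_alpha1 comp_mpolyXU -tnth_nth tnth_mktuple. Qed.

Lemma dvdS_kill_alpha1 (p : S) : dvdS 'X_k1 (p - kill_alpha1 p).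
Proof.
apply: dvdS_sub_lrmorph => k; rewrite /= kill_alpha1X.
by case: eqP => [->|_]; [exists 1|exists 0]; rewrite ?subr0 ?subrr ?mulr1 ?mulr0.
Qed.

(** The divided difference operator of a root maps S to itself. *)
Lemma dvdS_sact_tperm i j p : dvdS (root i j) (p + sact (tperm i j) p).
Proof.
rewrite -[X in _ + X]oppS; move: p; apply: dvdS_sub_lrmorph => k /=.
rewrite sactX wact_tperm lin_sub ?lin_tbasis; last exact: in_Tstar_wroot.
  by rewrite subKr -mul_mpolyC mulrC; eexists.
exact: in_Tstar_tbasis.
Qed.

(** Two roots that share exactly one index are coprime.  After transport they are
    alpha_1 and alpha_1 + alpha_2, and the second one does not vanish modulo the
    prime alpha_1. *)
Lemma dvdS_coprime i j k p : uniq [:: i; j; k] ->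
  dvdS (root i j) (root i k * p) -> dvdS (root i j) p.
Proof.
move=> ijk; have [l ijkl] : exists l, uniq [:: i; j; k; l].
  have [l lP] : exists l, l \notin [:: i; j; k].
    case: (pickP [pred x | x \notin [:: i; j; k]]) => [x xP|all_in].
      by exists x.
    suff sub : {subset enum 'I_4 <= [:: i; j; k]}.
      by have := uniq_leq_size (enum_uniq _) sub; rewrite -cardE card_ord.
    by move=> x _; have /negbFE := all_in x.
  by exists l; rewrite -[X in uniq X]/(rcons [:: i; j; k] l) rcons_uniq lP.
have [w [-> _ ->]] := sact_perm4 ijkl => /(dvdS_sact w^-1%g).
rewrite rmorphM /= -!sactM !mulVg !sact1 => -[q].
set p' := sact _ p => pq.
suff /(dvdS_sact w) : dvdS 'X_k1 p' by rewrite /p' -sactM mulgV sact1.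
have := congr1 kill_alpha1 pq.
rewrite !rmorphM rmorphD /= !kill_alpha1X eqxx /= mul0r add0r.
move/eqP; rewrite mulf_eq0 (negPf (mvar_neq0 _)) /= => /eqP p'0.
by have := dvdS_kill_alpha1 p'; rewrite p'0 subr0.
Qed.

(** * A lattice stable under divided differences *)

Lemma sact_tperm_root i j : sact (tperm i j) (root i j) = root i j.
Proof. by rewrite sact_root tpermV tpermL tpermR root_sym. Qed.

Lemma tpermKl (i j : 'I_4) (w : 'S_4) : (tperm i j * (tperm i j * w) = w)%g.
Proof. by rewrite mulgA tperm2 mul1g. Qed.

Lemma tperm_commute i j k l (w : 'S_4) : uniq [:: i; j; k; l] ->
  (tperm i j * (tperm k l * w) = tperm k l * (tperm i j * w))%g.
Proof.
rewrite /= !inE !negb_or -!andbA => /and5P[_ ik il jk /andP[jl _]].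
have e : tperm k l = (tperm k l ^ tperm i j)%g by rewrite tpermJ !tpermD.
by rewrite [in RHS]e conjgE tpermV -!mulgA tpermKl.
Qed.

Lemma tperm_conj i j a b (w : 'S_4) :
  (tperm i j * (tperm a b * w) =
   tperm (tperm i j a) (tperm i j b) * (tperm i j * w))%g.
Proof. by rewrite -tpermJ conjgE tpermV -!mulgA tpermKl. Qed.

(** Two ways of splitting the indices into pairs either give the same two
    orthogonal reflections, with the same root modulo 2, or give coprime
    roots. *)
Lemma uniq4_cases i j k l i' j' k' l' :
    uniq [:: i; j; k; l : 'I_4] -> uniq [:: i'; j'; k'; l'] ->
  [\/ [/\ tperm i' j' = tperm i j, tperm k' l' = tperm k l & root i' j' = root i j],
      [/\ tperm i' j' = tperm k l, tperm k' l' = tperm i j & root i' j' = root i j] |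
      forall p, dvdS (root i' j') (root i j * p) -> dvdS (root i' j') p].
Proof.
move=> uP uP'.
have all_in x : x \in [:: i; j; k; l].
  apply/negPn/negP => xn.
  have : uniq [:: x, i, j, k & [:: l]] by rewrite [uniq _]/= xn.
  move/card_uniqP => e; have := max_card (mem [:: x, i, j, k & [:: l]]).
  by rewrite card_ord e.
have [ij ik il jk [jl kl]] : [/\ i != j, i != k, i != l, j != k & j != l /\ k != l].
  by move: uP; rewrite /= !inE !negb_or -!andbA => /and5P[-> -> -> -> /and3P[-> -> _]].
(* Up to the symmetry of roots, the two roots share a as common index. *)
have cop a b c p : a != b -> a != c -> b != c ->
    dvdS (root a b) (root a c * p) -> dvdS (root a b) p.
  by move=> ab ac bc; apply: dvdS_coprime; rewrite /= !inE negb_or ab ac bc.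
move: (all_in i') (all_in j') (all_in k') (all_in l') uP'.
rewrite !inE => /or4P[]/eqP-> /or4P[]/eqP-> /or4P[]/eqP-> /or4P[]/eqP-> //=.
all: rewrite !inE ?eqxx ?orbT ?andbF //= => _.
all: first [ constructor 1; split; by rewrite // ?(root_sym j i) 1?tpermC
           | constructor 2; split; by rewrite ?(root_compl uP) // ?(root_sym l k) 1?tpermC
           | constructor 3 => p ].
all: rewrite ?[root k _]root_sym ?[root l _]root_sym.
all: first [ apply: (cop i k j) | apply: (cop i l j)
           | rewrite (root_sym i j); apply: (cop j k i)
           | rewrite (root_sym i j); apply: (cop j l i) ].
all: by rewrite // eq_sym.
Qed.

(** The localization congruences of equivariant Chow theory.  Before reduction
    modulo 2 the alternating sum over two orthogonal reflections is divisible by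
    the product of their two distinct roots.  Both roots become the same element
    modulo 2, so the second congruence no longer follows from the first one and
    has to be recorded: without it the first one is not stable under divided
    differences. *)
Definition lattice (f : 'S_4 -> S) : Prop :=
  forall i j k l w, uniq [:: i; j; k; l] ->
  dvdS (root i j) (f w + f (tperm i j * w)%g) /\
  dvdS (root i j ^+ 2) (f w + f (tperm i j * w)%g +
     (f (tperm k l * w)%g + f (tperm i j * (tperm k l * w))%g)).


(** For the two reflections with root r = e_i - e_j, stability holds because a
    divided difference of a multiple of r is again a multiple of r, and because
    the second congruence on f provides the first one on g.  For the other
    reflections both congruences hold for r * g, by conjugating with the
    reflection of r, and r can be cancelled by coprimality. *)
Lemma lattice_Xroot (f : 'S_4 -> S) i j : lattice f -> i != j ->
  exists2 g, lattice g &
    forall w, root i j * g w = f w + sact (tperm i j) (f (tperm i j * w)%g).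
Proof.
move=> fL ij; have [k [l ijkl]] := uniq4_ext ij.
set r := root i j; set s := tperm i j.
have r0 : r != 0 by apply: root_neq0.
have rs : sact s r = r by apply: sact_tperm_root.
have [g gE] : exists g, forall w, r * g w = f w + sact s (f (s * w)%g).
  apply: (@fin_all_exists _ _ (fun w q => r * q = f w + sact s (f (s * w)%g))) => w.
  have [q qE] : dvdS r (f w + sact s (f (s * w)%g)); last by exists q.
  have [fw _] := fL i j k l w ijkl.
  have := dvdSD fw (dvdS_sact_tperm i j (f (s * w)%g)).
  by rewrite -addrA (addrA (f (s * w)%g)) addSS add0r.
exists g => //.
have drs p : dvdS r p -> dvdS (r ^+ 2) (p + sact s p).
  move=> [q ->]; have [q' qE] := dvdS_sact_tperm i j q; exists q'.
  by rewrite rmorphM /= rs -mulrDr qE mulrA.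
(* g is invariant under its own reflection, as the image of a divided difference. *)
have gs w : g (s * w)%g = sact s (g w).
  apply: (mulfI r0); rewrite gE -{1}rs -rmorphM gE rmorphD /= -sactM tperm2 sact1.
  by rewrite tpermKl addrC.
have gk w : dvdS r (g w + g (tperm k l * w)%g).
  have klij : uniq [:: k; l; i; j] by rewrite -(rot_uniq 2).
  have [_ [q qE]] := fL i j k l w ijkl.
  have [fk _] := fL k l i j (s * w)%g klij.
  move: fk; rewrite -(root_compl ijkl) -(tperm_commute _ ijkl) => /drs[q' q'E].
  exists (q + q'); apply: (mulfI r0); rewrite mulrA -expr2 [RHS]mulrDr -qE -q'E.
  rewrite mulrDr !gE rmorphD /=.
  set a := f w; set b := f (s * w)%g; set c := f (tperm k l * w)%g.
  set d := f (s * (tperm k l * w))%g; rewrite -/s -/b -/c -/d.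
  (* The terms b and d occur twice, and cancel. *)
  have -> : a + b + (c + d) + (b + d + (sact s b + sact s d)) =
    a + sact s b + (c + sact s d) + (b + b + (d + d)) by ring.
  by rewrite !addSS !addr0.
move=> i' j' k' l' w ijkl'.
case: (uniq4_cases ijkl ijkl') => [[sE sE' rE]|[sE sE' rE]|cop].
- rewrite rE sE sE' -/s !gs; split; first exact: dvdS_sact_tperm.
  by rewrite addrACA -rmorphD; apply: drs.
- rewrite rE sE sE' -/s -(tperm_commute _ ijkl) !gs; split; first exact: gk.
  by rewrite -rmorphD; apply: drs.
have conjL : 
  dvdS (root i' j') (r * (g w + g (tperm i' j' * w)%g)) /\
  dvdS (root i' j' ^+ 2) (r * (g w + g (tperm i' j' * w)%g +
    (g (tperm k' l' * w)%g + g (tperm i' j' * (tperm k' l' * w))%g))).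
  have [f1 f2] := fL i' j' k' l' w ijkl'.
  have sijkl' : uniq (map s [:: i'; j'; k'; l']).
    by rewrite map_inj_uniq //; apply: perm_inj.
  have [h1 h2] := fL (s i') (s j') (s k') (s l') (s * w)%g sijkl'.
  have rootE : sact s (root (s i') (s j')) = root i' j' by rewrite sact_root !permK.
  move: h1 h2 => /(dvdS_sact s) h1 /(dvdS_sact s).
  rewrite -!tperm_conj in h1 *; rewrite rmorphXn /= rootE in h1 * => h2.
  rewrite !mulrDr !gE !rmorphD /= in h1 h2 *; split.
    by rewrite addrACA; apply: dvdSD.
  by have [q qE] := dvdSD f2 h2; exists q; rewrite -qE -/s; ring.
have [h1 h2] := conjL; split; first exact: cop.
(* The square is divided out one factor at a time. *)
case: h2 => q; move: (_ + _ + (_ + _)) => x h2; have [|q' q'E] := cop x.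
  by rewrite h2 expr2 -mulrA; eexists.
rewrite q'E in h2 *; have [|q'' ->] := cop q'.
  exists q; apply: (mulfI (root_neq0 (_ : i' != j'))).
    by move: ijkl'; rewrite /= !inE !negb_or -!andbA => /andP[].
  by rewrite mulrCA h2 expr2 -mulrA.
by exists q''; rewrite mulrA expr2.
Qed.
End CharTwo.

(** * Functions that pair with D into S *)

Section Pairing.
Variable R : idomainType.
Hypothesis R2 : 2%N \in [pchar R].

Notation S := (sym R).
Notation F := {fraction S}.
Notation "x %:F" := (@FracField.tofrac S x).
Notation root i j := (lin R (wroot i j)).

(** For f constant on cosets this is the evaluation of f on the image of z in
    Q_{W/W_P}.  Working on W itself avoids the choice of representatives. *)
Definition pairing (f : 'S_4 -> S) (z : twalg R) : F := \sum_w (f w)%:F * z w.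

Lemma pairing_ext f g z : f =1 g -> pairing f z = pairing g z.
Proof. by move=> fg; apply: eq_bigr => w _; rewrite fg. Qed.

Lemma pairingDr f y z : pairing f (y + z) = pairing f y + pairing f z.
Proof. by rewrite -big_split; apply: eq_bigr => w _; rewrite ffunE mulrDr. Qed.

Lemma pairingBr f y z : pairing f (y - z) = pairing f y - pairing f z.
Proof. by rewrite -sumrB; apply: eq_bigr => w _; rewrite !ffunE mulrBr. Qed.

Lemma qdelta_mulE q v (y : twalg R) u :
  (qdelta q v * y) u = q * fracact v (y (v^-1 * u)%g).
Proof.
rewrite ffunE (bigD1 v) //= big1 => [|w /negPf wv]; last by rewrite ffunE wv mul0r.
by rewrite ffunE eqxx addr0.
Qed.

Lemma pairing_qdelta f q v (y : twalg R) :
  pairing f (qdelta q v * y) =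
    q * fracact v (pairing (fun w => sact v^-1%g (f (v * w)%g)) y).
Proof.
rewrite /pairing (reindex_inj (mulgI v)) rmorph_sum mulr_sumr; apply: eq_bigr => w _.
rewrite qdelta_mulE mulKg rmorphM /= fracact_tofrac -sactM mulgV sact1.
by rewrite mulrCA.
Qed.

Lemma pairing_S f (p : S) (y : twalg R) :
  pairing f (qdelta p%:F 1%g * y) = p%:F * pairing f y.
Proof.
rewrite pairing_qdelta fracact1; congr (_ * _); apply: pairing_ext => w.
by rewrite invg1 sact1 mul1g.
Qed.

(** Pairing with X_alpha y is computed by a divided difference of the pairing with
    y, corrected by the pairing of y with the function obtained from f by
    X_alpha: a twisted Leibniz rule. *)
Lemma pairing_Xroot f g i j (y : twalg R) : i != j ->
    (forall w, root i j * g w = f w + sact (tperm i j) (f (tperm i j * w)%g)) ->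
  pairing f (Xroot R i j * y) =
    (pairing f y + fracact (tperm i j) (pairing f y)) / rootS R i j
      + fracact (tperm i j) (pairing g y).
Proof.
move=> ij gE; have r0 : rootS R i j != 0 by rewrite tofrac_eq0 root_neq0.
rewrite /Xroot -mulrA mulrBl mul1r pairing_qdelta fracact1 mulrC.
apply: (canLR (mulfK r0)); rewrite (pairing_ext (g := f)); last first.
  by move=> w; rewrite invg1 sact1 mul1g.
rewrite pairingBr pairing_qdelta mul1r mulrDl mulfVK // -addrA; congr (_ + _).
rewrite (oppF R2) tpermV -[rootS R i j]/((root i j)%:F) -[in RHS](sact_tperm_root R2).
rewrite -fracact_tofrac -rmorphM -rmorphD; congr (fracact _ _).
rewrite mulr_suml -big_split /=; apply: eq_bigr => w _.
have -> : sact (tperm i j) (f (tperm i j * w)%g) = f w + root i j * g w.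
  by rewrite gE addrA addSS ?add0r.
by rewrite tofracD tofracM; ring.
Qed.

(** The elements x for which this implication holds for all y form a subalgebra of
    Q_W, so only the generators of D have to be considered. *)
Lemma inS_pairing_mul x y : inD x ->
    (forall f, lattice f -> inS (pairing f y)) ->
  forall f, lattice f -> inS (pairing f (x * y)).
Proof.
move=> xD; elim: x / xD y => [p|i j ij|x x' _ IHx _ IHx'|x x' _ IHx _ IHx'] y yS f fL.
- by rewrite pairing_S; have [q ->] := yS f fL; exists (p * q); rewrite tofracM.
- have [g gL gE] := lattice_Xroot R2 fL ij; rewrite (pairing_Xroot _ ij gE).
  have [[p ->] [q ->]] := (yS f fL, yS g gL); rewrite !fracact_tofrac -tofracD.
  have [h ->] := dvdS_sact_tperm R2 i j p; exists (h + sact (tperm i j) q).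
  rewrite tofracD tofracM [_ * h%:F]mulrC mulfK // tofrac_eq0.
  exact: root_neq0.
- rewrite mulrDl pairingDr; have [p ->] := IHx y yS f fL; have [q ->] := IHx' y yS f fL.
  by exists (p + q); rewrite tofracD.
- by rewrite -mulrA; apply: IHx fL => g gL; apply: IHx'.
Qed.

Lemma inS_pairing f z : lattice f -> inD z -> inS (pairing f z).
Proof.
move=> fL zD; rewrite -[z]mulr1; apply: inS_pairing_mul zD _ f fL => f fL.
exists (f 1%g); rewrite /pairing (bigD1 1%g) //= big1 => [|w /negPf w1].
  by rewrite ffunE eqxx mulr1 addr0.
by rewrite ffunE w1 mulr0.
Qed.

(** Every root appears twice up to sign, so disc is divisible by the square of each
    root; it is also W-invariant. *)
Definition disc : S := \prod_(ij : 'I_4 * 'I_4 | ij.1 != ij.2) root ij.1 ij.2.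

Lemma disc_neq0 : disc != 0.
Proof.
rewrite /disc; apply: (big_ind (fun p : S => p != 0)) => [|p q|ij ij'].
- exact: oner_neq0.
- exact: mulf_neq0.
- exact: root_neq0.
Qed.

Lemma sact_disc w : sact w disc = disc.
Proof.
rewrite rmorph_prod /=.
rewrite [RHS](reindex_inj (h := fun ij => (w^-1%g ij.1, w^-1%g ij.2))) /=.
  by apply: eq_big => [ij|ij _]; rewrite ?(inj_eq perm_inj) ?sact_root.
by move=> [a b] [c d] /= [/perm_inj-> /perm_inj->].
Qed.

Lemma dvdS_disc i j : i != j -> dvdS (root i j ^+ 2) disc.
Proof.
move=> ij; rewrite /disc (bigD1 (i, j)) //= (bigD1 (j, i)) /=.
  by rewrite mulrA (root_sym R2 j i) -expr2; eexists.
by rewrite eq_sym ij xpair_eqE negb_and eq_sym ij.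
Qed.

Lemma lattice_disc (g : 'S_4 -> S) : lattice (fun w => disc * g w).
Proof.
move=> i j k l w; rewrite /= !inE !negb_or -!andbA => /andP[ij _].
have [q qE] := dvdS_disc ij; rewrite -!mulrDr qE; split; last first.
  by apply: dvdS_mulr; eexists.
by rewrite expr2 -!mulrA; eexists.
Qed.

Lemma in_DPstar_disc (g : {ffun minrep -> S}) :
  in_DPstar [ffun v => (disc * g v)%:F].
Proof.
split=> [v|_ [z zD ->]].
  by exists (disc * g v), 0%N; rewrite ffunE expr0 divr1.
suff -> : ev [ffun v => (disc * g v)%:F] (Defs.pmap z) =
    pairing (fun w => disc * g (bar w)) z.
  by apply: inS_pairing zD; apply: lattice_disc.
rewrite /ev /pairing (partition_big bar predT) //=; apply: eq_bigr => v _.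
by rewrite !ffunE mulr_sumr; apply: eq_bigr => w /eqP->.
Qed.
End Pairing.

(** * Endomorphisms as matrices *)

Section Endomorphism.
Variable R : idomainType.
Hypothesis R2 : 2%N \in [pchar R].

Notation S := (sym R).
Notation F := {fraction S}.
Notation "x %:F" := (@FracField.tofrac S x).
Notation disc := (disc R).

Lemma odot_qdelta q w (f : {ffun minrep -> F}) v :
  odot (qdelta q w) f (bar (w * val v)%g) = q * fracact w (f v).
Proof.
rewrite ffunE (bigD1 w) //= [X in _ + X]big1 => [|w' /negPf w'w]; last first.
  by apply: big1 => u _; rewrite ffunE w'w mul0r.
rewrite addr0 (big_pred1 v) => [|u]; first by rewrite ffunE eqxx.
by apply/eqP/eqP=> [/bar_mul_inj|->//]; rewrite !barK.
Qed.

Lemma odot_scalar q (f : {ffun minrep -> F}) v : odot (qdelta q 1%g) f v = q * f v.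
Proof. by have := odot_qdelta q 1%g f v; rewrite mul1g barK fracact1. Qed.

(** The reflection is recovered from delta_s = 1 - alpha X_alpha. *)
Lemma inD_tperm i j : i != j -> inD (qdelta 1 (tperm i j) : twalg R).
Proof.
move=> ij; have -> : qdelta 1 (tperm i j) =
    qdelta 1%:F 1%g + qdelta (- lin R (wroot i j))%:F 1%g * Xroot R i j.
  rewrite /Xroot mulrA qdeltaM fracact1 mulg1 tofracN mulNr mulfV; last first.
    by rewrite tofrac_eq0 root_neq0.
  apply/ffunP=> w; rewrite [RHS]ffunE qdelta_mulE fracact1 invg1 mul1g !ffunE.
  by rewrite tofrac1 mulN1r opprB addrC subrK.
apply: inD_add; first exact: inD_S.
by apply: inD_mul; [apply: inD_S|apply: inD_X].
Qed.

Lemma inD_delta w : inD (qdelta 1 w : twalg R).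
Proof.
have [ts -> tsP] := prod_tpermP w.
elim: ts tsP => [|[i j] ts IHts] /=.
  by rewrite big_nil -tofrac1 => _; apply: inD_S.
case/andP=> ij /IHts tsD; rewrite big_cons.
by have := inD_mul (inD_tperm ij) tsD; rewrite qdeltaM rmorph1 mulr1.
Qed.

Lemma common_denom (f : {ffun minrep -> F}) :
  exists2 m : S, m != 0 &
    exists g : {ffun minrep -> S}, forall v, m%:F * f v = (g v)%:F.
Proof.
pose d v := \d_(repr (f v)); have d0 v : d v != 0 by apply: denom_ratioP.
exists (\prod_v d v); first by apply/prodf_neq0.
exists [ffun v => \n_(repr (f v)) * \prod_(u | u != v) d u] => v.
rewrite ffunE [in LHS](numden (f v)) (bigD1 v) //= !tofracM -/(d v) mulrC mulrA.
by rewrite mulfVK ?tofrac_eq0.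
Qed.

Variable phi : {ffun minrep -> F} -> {ffun minrep -> F}.
Hypothesis phi_endo : DPstar_endo phi.
Hypothesis phi_idem : forall f, in_DPstar f -> phi (phi f) = phi f.

Let emb (g : {ffun minrep -> S}) : {ffun minrep -> F} := [ffun v => (disc * g v)%:F].
Let e (u : minrep) : {ffun minrep -> F} := fdelta disc%:F u.
(** The division by disc makes B the matrix of phi extended to all functions with
    values in F: e u is disc times the coordinate function of u. *)
Let B u v : F := phi (e u) v / disc%:F.

Let disc0 : disc%:F != 0.
Proof. by rewrite tofrac_eq0 disc_neq0. Qed.

Let BE u v : phi (e u) v = disc%:F * B u v.
Proof. by rewrite mulrC divfK. Qed.

Let emb_in g : in_DPstar (emb g).
Proof. exact: in_DPstar_disc. Qed.

Let e_in u : in_DPstar (e u).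
Proof.
suff -> : e u = emb [ffun v => (v == u)%:R] by apply: emb_in.
by apply/ffunP=> v; rewrite !ffunE; case: eqP; rewrite ?mulr1 ?mulr0 ?tofrac0.
Qed.

Let embD g h : emb (g + h) = emb g + emb h.
Proof. by apply/ffunP=> v; rewrite !ffunE mulrDr tofracD. Qed.

Let phi_embD g h : phi (emb (g + h)) = phi (emb g) + phi (emb h).
Proof. by rewrite embD (endo_add phi_endo). Qed.

Let phi_emb0 : phi (emb 0) = 0.
Proof.
by apply: (@addrI _ (phi (emb 0))); rewrite -phi_embD !addr0.
Qed.

Let phi_emb g v : phi (emb g) v = \sum_u (g u)%:F * phi (e u) v.
Proof.
have gE : g = \sum_u [ffun x => if x == u then g u else 0].
  apply/ffunP=> x; rewrite sum_ffunE (bigD1 x) //= big1 ?addr0 => [|u /negPf ux].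
    by rewrite ffunE eqxx.
  by rewrite ffunE eq_sym ux.
rewrite [in LHS]gE (big_morph (fun g => phi (emb g)) phi_embD phi_emb0) sum_ffunE.
apply: eq_bigr => u _.
transitivity (phi (odot (qdelta (g u)%:F 1%g) (e u)) v); last first.
  by rewrite (endo_odot phi_endo) ?odot_scalar //; apply: inD_S.
congr (phi _ _); apply/ffunP=> x; rewrite odot_scalar !ffunE.
by case: eqP => _; rewrite ?mulr0 ?tofrac0 // mulrC tofracM.
Qed.

(** A common denominator m of the values of f moves f into the image of emb, and
    phi commutes with multiplication by m and by disc, which belong to D. *)
Let phiE f v : in_DPstar f -> phi f v = \sum_u f u * B u v.
Proof.
move=> fD; have [m m0 [g gE]] := common_denom f.
have mF0 : (disc * m)%:F != 0 by rewrite tofrac_eq0 mulf_neq0 // disc_neq0.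
apply: (mulfI mF0); rewrite -odot_scalar -(endo_odot phi_endo) //; last exact: inD_S.
have -> : odot (qdelta (disc * m)%:F 1%g) f = emb g.
  by apply/ffunP=> u; rewrite odot_scalar !ffunE !tofracM -mulrA gE.
rewrite phi_emb mulr_sumr; apply: eq_bigr => u _.
by rewrite BE -gE tofracM; ring.
Qed.

Let B_idem u v : B u v = \sum_x B u x * B x v.
Proof.
apply: (mulfI disc0); rewrite -BE -(phi_idem (e_in u)) phiE; last first.
  exact: (endo_stable phi_endo (e_in u)).
by rewrite mulr_sumr; apply: eq_bigr => x _; rewrite [RHS]mulrA -BE.
Qed.

Let B_act w u v : B (bar (w * u)) (bar (w * v)) = fracact w (B (bar u) (bar v)).
Proof.
rewrite -(bar_mul_val w u) -(bar_mul_val w v); apply: (mulfI disc0); rewrite -BE.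
have -> : e (bar (w * val (bar u))) = odot (qdelta 1 w) (e (bar u)).
  by rewrite odotE mul1r fracact_tofrac sact_disc.
rewrite (endo_odot phi_endo) //; last exact: inD_delta.
by rewrite odot_qdelta mul1r BE rmorphM /= fracact_tofrac sact_disc.
Qed.

Let B_klein k i a j b :
  B (bar (coset_rep (i, a (+) (i != k)))) (bar (coset_rep (j, b (+) (j != k)))) =
  B (bar (coset_rep (i, a))) (bar (coset_rep (j, b))).
Proof.
by rewrite -!klein_coset_rep B_act /fracact !(sact_klein R2) -numden.
Qed.

(** Every v in W^P is bar (coset_rep a) for a unique a, so the matrix B is a matrix
    over the index type of klein_idempotent. *)
Lemma idempotent_trivial :
  (forall f, in_DPstar f -> phi f = 0) \/ (forall f, in_DPstar f -> phi f = f).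
Proof.
have [h ptK hK] := coset_rep_bij.
pose C a b := B (bar (coset_rep a)) (bar (coset_rep b)).
have C_idem a b : C a b = \sum_c C a c * C c b.
  rewrite /C B_idem (reindex (fun c => bar (coset_rep c))) //=.
  by exists h => c _; [apply: ptK|apply: hK].
have C_diag a b : C a a = 0 -> C b b = 0.
  have -> : C b b = fracact (coset_rep b * (coset_rep a)^-1)%g (C a a).
    by rewrite /C -B_act mulgKV.
  by move=> ->; rewrite rmorph0.
have BC u v : B u v = C (h u) (h v) by rewrite /C !hK.
have [C0|C1] := klein_idempotent (addFF R2) B_klein C_idem C_diag.
- left=> f fD; apply/ffunP=> v; rewrite phiE // big1 ?ffunE // => u _.
  by rewrite BC C0 mulr0.
right=> f fD; apply/ffunP=> v; rewrite phiE // (bigD1 v) //= big1 => [|u /negPf uv].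
  by rewrite BC C1 eqxx mulr1 addr0.
by rewrite BC C1 (can_eq hK) uv mulr0.
Qed.
End Endomorphism.

Theorem proposition7p4 : DPstar_indecomposable 'F_2.
Proof.
move=> phi phi_endo phi_idem.
exact: (idempotent_trivial (pchar_Fp (isT : prime 2)) phi_endo phi_idem).
Qed.
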